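(* Let $p\in(0,1)$ and $\mu>0$, and let $\beta_0=[2\mu(1-p)]^{\frac{1}{2-p}}$. Define the operator $\Gamma_\mu:\mathbb{R}\to\mathbb{R}$ by $$\Gamma_\mu(\beta):=\begin{cases}0,&\text{if }\beta\le\dfrac{\beta_0(2-p)}{2(1-p)},\\[2mm] t^*,&\text{otherwise},\end{cases}$$ where $t^*\in[\beta_0/\beta,1)$ is the unique solution of $$\mu\beta^{p-2}p\,t^{p-1}+t-1=0,\qquad t\in[\beta_0/\beta,\infty).$$ Then a solution of the proximal operator of the tensor $\ell_{2,p}$ norm at $\widetilde{\mathcal{S}}\in\mathbb{R}^{I_1\times I_2\times I_3}$ can be computed by $$\Gamma_\mu(\|\tilde{\boldsymbol{s}}_{:i_2i_3}\|_2)\,\tilde{\boldsymbol{s}}_{:i_2i_3}\in\operatorname{prox}_{\mu\|\cdot\|_2^p}(\tilde{\boldsymbol{s}}_{:i_2i_3})=\left(\operatorname{prox}_{\mu\|\cdot\|_{2,p}^p}(\widetilde{\mathcal{S}})\right)_{:i_2i_3}$$ for $i_2=1,2,\dots,I_2$, $i_3=1,2,\dots,I_3$.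
   Context: For a third order tensor $\mathcal{S}\in\mathbb{R}^{I_1\times I_2\times I_3}$, $\boldsymbol{s}_{:i_2i_3}\in\mathbb{R}^{I_1}$ denotes its $(i_2,i_3)$-th mode-1 fiber, i.e. the vector $(s_{1i_2i_3},\dots,s_{I_1i_2i_3})$; the fibers of $\widetilde{\mathcal{S}}$ are written $\tilde{\boldsymbol{s}}_{:i_2i_3}$. The tensor $\ell_{2,p}$ (quasi-)norm is $$\|\mathcal{S}\|_{2,p}=\Big(\sum_{i_3=1}^{I_3}\sum_{i_2=1}^{I_2}\|\boldsymbol{s}_{:i_2i_3}\|_2^p\Big)^{1/p}.$$ The proximal operators are set-valued: $$\operatorname{prox}_{\mu\|\cdot\|_{2,p}^p}(\widetilde{\mathcal{S}})=\arg\min_{\mathcal{S}\in\mathbb{R}^{I_1\times I_2\times I_3}}\Big[\mu\|\mathcal{S}\|_{2,p}^p+\tfrac12\|\mathcal{S}-\widetilde{\mathcal{S}}\|_F^2\Big],\qquad \operatorname{prox}_{\mu\|\cdot\|_2^p}(\tilde{\boldsymbol{s}})=\arg\min_{\boldsymbol{s}\in\mathbb{R}^{I_1}}\Big[\mu\|\boldsymbol{s}\|_2^p+\tfrac12\|\boldsymbol{s}-\tilde{\boldsymbol{s}}\|_2^2\Big],$$ where $\|\cdot\|_F$ is the Frobenius norm. For a set $A$ of tensors, $(A)_{:i_2i_3}$ denotes the set of $(i_2,i_3)$-th mode-1 fibers of elements of $A$. *)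

(* Defs.v *)
From mathcomp Require Import all_boot all_order all_algebra.
From mathcomp Require Import all_classical all_reals all_analysis.
Set Implicit Arguments.
Unset Strict Implicit.
Unset Printing Implicit Defensive.
Import Order.TTheory GRing.Theory Num.Theory.
Local Open Scope classical_set_scope.
Local Open Scope ring_scope.

Notation tensor3 R I1 I2 I3 :=
  {ffun 'I_I1 * 'I_I2 * 'I_I3 -> R} (only parsing).

Definition fiber1 (R : realType) (I1 I2 I3 : nat) (S : tensor3 R I1 I2 I3)
  (i2 : 'I_I2) (i3 : 'I_I3) : 'cV[R]_I1 := \col_i1 S (i1, i2, i3).

(* The norm `|v| that MathComp-Analysis puts on matrices is the sup norm,
   so the Euclidean and Frobenius norms are spelled out. *)
Definition norm2 (R : realType) (n : nat) (v : 'cV[R]_n) : R :=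
  Num.sqrt (\sum_i v i ord0 ^+ 2).

Definition normF (R : realType) (I1 I2 I3 : nat) (S : tensor3 R I1 I2 I3) : R :=
  Num.sqrt (\sum_i S i ^+ 2).

Definition norm2p (R : realType) (I1 I2 I3 : nat) (p : R)
  (S : tensor3 R I1 I2 I3) : R :=
  (\sum_i3 \sum_i2 norm2 (fiber1 S i2 i3) `^ p) `^ (1 / p).

Definition argmin (R : realType) (T : Type) (f : T -> R) : set T :=
  [set x | forall y, f x <= f y].

Definition prox_vec (R : realType) (n : nat) (p mu : R) (v : 'cV[R]_n) :
  set 'cV[R]_n :=
  argmin (fun s : 'cV[R]_n => mu * norm2 s `^ p + 1 / 2 * norm2 (s - v) ^+ 2).

Definition prox_tensor (R : realType) (I1 I2 I3 : nat) (p mu : R)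
  (V : tensor3 R I1 I2 I3) : set (tensor3 R I1 I2 I3) :=
  argmin (fun S : tensor3 R I1 I2 I3 =>
    mu * norm2p p S `^ p + 1 / 2 * normF (S - V) ^+ 2).

Definition beta0 (R : realType) (p mu : R) : R :=
  (2 * mu * (1 - p)) `^ (1 / (2 - p)).

Definition threshold (R : realType) (p mu : R) : R :=
  beta0 p mu * (2 - p) / (2 * (1 - p)).

Definition shrink_root (R : realType) (p mu beta : R) : set R :=
  [set t | beta0 p mu / beta <= t /\
           mu * beta `^ (p - 2) * p * t `^ (p - 1) + t - 1 = 0].

(* xget picks an element of the set of roots (0 if there is none); it is the
   t^* of the definition only once that set is known to be a singleton. *)
Definition Gamma (R : realType) (p mu beta : R) : R :=
  if beta <= threshold p mu then 0 else xget 0 (shrink_root p mu beta).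

(* Main.v *)
(** The objective of the tensor problem is a sum over the mode-1 fibers, so minimizing it means
    minimizing each fiber separately.  For one fiber [v], Cauchy-Schwarz gives
    [norm2 (s - v) >= | norm2 s - norm2 v |] with equality when [s] is a nonnegative multiple of [v],
    which leaves the scalar problem of minimizing [mu * r `^ p + (r - beta) ^+ 2 / 2] over [r >= 0]
    with [beta = norm2 v].  In place of derivatives, a single tangent inequality for the convex
    function [r |-> r `^ (p - 1)] does all the work: taken at [beta0] it shows that [0] is a minimizer
    up to the threshold, and taken at a stationary point [s >= beta0], where
    [2 * mu * (1 - p) * s `^ (p - 1) <= s], it shows both that [s] is a minimizer and that
    [r |-> mu * p * r `^ (p - 1) + r] is increasing beyond [beta0]. *)

Require Import Defs.
From mathcomp Require Import all_boot all_order all_algebra.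
From mathcomp Require Import all_classical all_reals all_analysis.
From mathcomp Require Import ring lra.
Import Order.TTheory GRing.Theory Num.Theory.
Import numFieldNormedType.Exports.
Local Open Scope classical_set_scope.
Local Open Scope ring_scope.

(** * The tangent inequality and powers of [beta0] *)

Lemma powR_ge_tangent {R : realType} {a s r : R} : a <= 0 -> 0 < s -> 0 < r ->
  s `^ a * (s + a * (r - s)) <= s * r `^ a.
Proof.
move=> a0 s0 r0.
have x0 : 0 < r / s by rewrite divr_gt0.
(* Bernoulli for [x = r / s]: [expR (a * ln x) >= 1 + a * ln x], and [ln x <= x - 1] is reversed by
   [a <= 0]. *)
have bern : 1 + a * (r / s - 1) <= (r / s) `^ a.
  rewrite [leRHS]/powR gt_eqF//; apply: le_trans (expR_ge1Dx _).
  rewrite lerD2l; apply: ler_wnM2l => //.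
  have := @le_ln1Dx _ (r / s - 1).
  by rewrite addrCA subrr addr0; apply; lra.
have -> : r `^ a = (r / s) `^ a * s `^ a.
  by rewrite -powRM ?(ltW x0) ?(ltW s0)// divfK ?gt_eqF.
have -> : s `^ a * (s + a * (r - s)) = s * ((1 + a * (r / s - 1)) * s `^ a).
  by field; rewrite gt_eqF.
by rewrite ler_pM2l// ler_pM2r// powR_gt0.
Qed.

Lemma beta0_gt0 {R : realType} {p mu : R} : p < 1 -> 0 < mu -> 0 < beta0 p mu.
Proof. by move=> p1 mu0; rewrite powR_gt0// !mulr_gt0// subr_gt0. Qed.

Lemma powR_beta0 {R : realType} {p mu : R} : p < 1 -> 0 < mu ->
  beta0 p mu `^ (2 - p) = 2 * mu * (1 - p).
Proof.
move=> p1 mu0; rewrite /beta0 -powRrM mul1r mulVf ?powRr1//.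
  by rewrite !mulr_ge0// ?(ltW mu0)//; lra.
by rewrite gt_eqF//; lra.
Qed.

Lemma powR2B_mul {R : realType} (p : R) {s : R} : 0 < s ->
  s `^ (2 - p) * s `^ (p - 1) = s.
Proof.
move=> s0; rewrite -powRD; last by rewrite (gt_eqF s0) implybT.
by rewrite (_ : 2 - p + (p - 1) = 1) ?powRr1 ?ltW//; ring.
Qed.

(** Multiply [beta0]^ (2 - p) <= s [^ (2 - p)] by [s]^ (p -
    1)[. The bound keeps the second derivative]1 - mu * p * (1 - p) * s [^ (p - 2)] of the scalar
    objective at least [1 - p / 2]. *)
Lemma powR_beta0_le {R : realType} {p mu s : R} : p < 1 -> 0 < mu ->
  beta0 p mu <= s -> 2 * mu * (1 - p) * s `^ (p - 1) <= s.
Proof.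
move=> p1 mu0 bs; have b0 : 0 < beta0 p mu by exact: beta0_gt0.
have s0 : 0 < s := lt_le_trans b0 bs.
rewrite -powR_beta0// -[leRHS](powR2B_mul p s0) ler_pM2r ?powR_gt0//.
by rewrite ge0_ler_powR ?nnegrE ?(ltW b0) ?(ltW s0)//; lra.
Qed.

Lemma powR_mulB1 {R : realType} (p : R) {s : R} : 0 < s ->
  s `^ p = s * s `^ (p - 1).
Proof.
move=> s0; rewrite -{2}(powRr1 (ltW s0)) -powRD; last by rewrite (gt_eqF s0) implybT.
by congr (_ `^ _); ring.
Qed.

(** * The scalar problem and its stationary points *)

Local Notation stationary p mu s := (mu * p * s `^ (p - 1) + s).
(** Its derivative at [r > 0] is [stationary p mu r - beta]. *)
Local Notation objective p mu beta r :=
  (mu * r `^ p + 1 / 2 * (r - beta) ^+ 2).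

Lemma threshold_stationary {R : realType} {p mu : R}
    (hp0 : 0 < p) (hp1 : p < 1) (hmu : 0 < mu) :
  stationary p mu (beta0 p mu) = threshold p mu.
Proof.
rewrite /threshold; have := powR2B_mul p (beta0_gt0 hp1 hmu); rewrite powR_beta0// => bE.
have k0 : 2 * (1 - p) != 0 by rewrite gt_eqF// mulr_gt0// subr_gt0.
apply: (mulIf k0); rewrite divfK//.
transitivity (p * (2 * mu * (1 - p) * beta0 p mu `^ (p - 1)) +
              2 * (1 - p) * beta0 p mu); first by ring.
by rewrite bE; ring.
Qed.

Lemma beta0_le_threshold {R : realType} {p mu : R}
    (hp0 : 0 < p) (hp1 : p < 1) (hmu : 0 < mu) :
  beta0 p mu <= threshold p mu.
Proof.
by rewrite -(threshold_stationary hp0 hp1 hmu) lerDr !mulr_ge0 ?powR_ge0// ltW.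
Qed.

Lemma stationary_lt {R : realType} {p mu s r : R}
    (hp0 : 0 < p) (hp1 : p < 1) (hmu : 0 < mu) :
  beta0 p mu <= s -> s < r -> stationary p mu s < stationary p mu r.
Proof.
move=> bs sr; have s0 : 0 < s := lt_le_trans (beta0_gt0 hp1 hmu) bs.
have r0 : 0 < r := lt_trans s0 sr.
have := powR_beta0_le hp1 hmu bs.
have := powR_ge_tangent (a := p - 1) _ s0 r0.
have : 0 < s `^ (p - 1) by rewrite powR_gt0.
move: (s `^ _) (r `^ _) => S P S0 /(_ ltac:(lra)) t h.
rewrite -(ltr_pM2l s0).
have mup0 : 0 < mu * p by rewrite mulr_gt0.
have : mu * p * (S * (s + (p - 1) * (r - s))) <= mu * p * (s * P).
  by rewrite ler_pM2l.
have h2 : 0 < s - p * (mu * (1 - p) * S).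
  have : 0 < mu * (1 - p) * S by rewrite !mulr_gt0//; lra.
  by nra.
have : 0 < (r - s) * (s - p * (mu * (1 - p) * S)).
  by rewrite mulr_gt0// subr_gt0.
by nra.
Qed.

(** For [r > 0], the increase from [0] to [r], divided by [r], is [mu * r]^ (p - 1) + r / 2 -
    beta[. The convex function]mu * r [^ (p - 1) + r / 2] is least at [beta0], where its value is
    the threshold. *)
Lemma objective_below_threshold {R : realType} {p mu beta r : R}
    (hp0 : 0 < p) (hp1 : p < 1) (hmu : 0 < mu) :
  beta <= threshold p mu -> 0 <= r ->
  objective p mu beta 0 <= objective p mu beta r.
Proof.
move=> hb; rewrite le_eqVlt => /predU1P[<-//|r0].
rewrite powR0 ?gt_eqF// (powR_mulB1 p r0).
have := powR_ge_tangent (a := p - 1) _ (beta0_gt0 hp1 hmu) r0.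
have bE := powR2B_mul p (beta0_gt0 hp1 hmu); rewrite powR_beta0// in bE.
move: bE hb; rewrite -(threshold_stationary hp0 hp1 hmu).
have : 0 < beta0 p mu `^ (p - 1) by rewrite powR_gt0 ?beta0_gt0.
move: (beta0_gt0 hp1 hmu); move: (beta0 p mu `^ _) (r `^ _) => B P.
move: (beta0 p mu) => c c0 B0 bE hb /(_ ltac:(lra)) t.
suff : 0 <= mu * P + r / 2 - beta by nra.
suff : mu * p * B + c <= mu * P + r / 2 by lra.
rewrite -(ler_pM2l c0).
have : mu * (B * (c + (p - 1) * (r - c))) <= mu * (c * P) by rewrite ler_pM2l.
by nra.
Qed.

Lemma objective_stationary {R : realType} {p mu s r : R}
    (hp0 : 0 < p) (hp1 : p < 1) (hmu : 0 < mu) :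
  beta0 p mu <= s -> 0 <= r ->
  objective p mu (stationary p mu s) s <= objective p mu (stationary p mu s) r.
Proof.
move=> bs r0; have s0 : 0 < s := lt_le_trans (beta0_gt0 hp1 hmu) bs.
have := powR_beta0_le hp1 hmu bs.
rewrite (powR_mulB1 p s0).
have : 0 < s `^ (p - 1) by rewrite powR_gt0.
move: r0; rewrite le_eqVlt => /predU1P[<-|r0].
  (* The tangent inequality excludes [r = 0]; there the difference is exactly
     [s * (s - 2 * mu * (1 - p) * S) / 2]. *)
  by rewrite powR0 ?gt_eqF//; move: (s `^ _) => S S0 h; nra.
rewrite (powR_mulB1 p r0).
have := powR_ge_tangent (a := p - 1) _ s0 r0.
move: (s `^ _) (r `^ _) => S P /(_ ltac:(lra)) t S0 h.
rewrite -(ler_pM2l s0).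
have mur0 : 0 < mu * r by rewrite mulr_gt0.
have : mu * r * (S * (s + (p - 1) * (r - s))) <= mu * r * (s * P).
  by rewrite ler_pM2l.
have : 0 <= (r - s) ^+ 2 * (s - 2 * mu * (1 - p) * S).
  by rewrite mulr_ge0 ?sqr_ge0// subr_ge0.
by nra.
Qed.

(** Multiplying the equation for [t] by [beta] gives the stationarity equation for
    [s = t * beta]. *)
Lemma shrink_rootE {R : realType} {p mu beta t : R} :
  p < 1 -> 0 < mu -> 0 < beta ->
  shrink_root p mu beta t <->
  beta0 p mu <= t * beta /\ stationary p mu (t * beta) = beta.
Proof.
move=> hp1 hmu beta_gt0; rewrite /shrink_root /= ler_pdivrMr//.
have E : 0 < t -> stationary p mu (t * beta) - beta =
    beta * (mu * beta `^ (p - 2) * p * t `^ (p - 1) + t - 1).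
  move=> t0; rewrite powRM ?ltW// (powR_mulB1 (p - 1) beta_gt0).
  by rewrite (_ : p - 1 - 1 = p - 2); ring.
have t_gt0 : beta0 p mu <= t * beta -> 0 < t.
  by move=> /(lt_le_trans (beta0_gt0 hp1 hmu)); rewrite pmulr_lgt0.
split=> -[bt e]; split=> //; have := E (t_gt0 bt); rewrite e.
  by rewrite mulr0 => /subr0_eq.
by rewrite subrr => /esym/eqP; rewrite mulf_eq0 gt_eqF//= => /eqP.
Qed.

Lemma stationary_within_continuous {R : realType} (p mu x y : R) : 0 < x ->
  {within `[x, y], continuous (fun s => stationary p mu s)}.
Proof.
move=> x0; apply: continuous_in_subspaceT => s; rewrite inE/= in_itv/= => /andP[xs _].
have s0 : 0 < s := lt_le_trans x0 xs.
apply: cvgD; last exact: cvg_id.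
apply: cvgM; [exact: cvg_cst|apply: (_ : {for s, continuous (@powR R ^~ (p - 1))})].
apply: differentiable_continuous; apply/derivable1_diffP.
by apply: derivable_powR; rewrite in_itv/= s0.
Qed.

(** On the interval from [beta0] to [beta], [stationary] starts at the threshold, below [beta], and
    ends above [beta], so it takes the value [beta]; strict monotonicity gives uniqueness. *)
Lemma shrink_root_unique {R : realType} {p mu beta : R}
    (hp0 : 0 < p) (hp1 : p < 1) (hmu : 0 < mu) : threshold p mu < beta ->
  exists t, beta0 p mu / beta <= t < 1 /\ unique (shrink_root p mu beta) t.
Proof.
move=> hb; have b0 := beta0_gt0 hp1 hmu.
have b_beta : beta0 p mu < beta.
  by apply: le_lt_trans hb; exact: beta0_le_threshold.
have beta_gt0 : 0 < beta := lt_trans b0 b_beta.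
have beta_lt s : 0 < s -> s < stationary p mu s.
  by move=> s0; rewrite ltrDr !mulr_gt0// powR_gt0.
have [c] : exists2 c, c \in `[beta0 p mu, beta] & stationary p mu c = beta.
  apply: IVT; [exact: ltW|exact: stationary_within_continuous|].
  rewrite threshold_stationary// ge_min le_max (ltW hb)/=.
  by rewrite (ltW (beta_lt _ beta_gt0)) orbT.
rewrite in_itv/= => /andP[bc _] cE.
have c0 : 0 < c := lt_le_trans b0 bc.
have root_c : shrink_root p mu beta (c / beta).
  by apply/shrink_rootE => //; rewrite divfK ?gt_eqF.
exists (c / beta); split; last split=> // t /shrink_rootE-/(_ hp1 hmu beta_gt0)[bt tE].
  rewrite ler_pM2r ?invr_gt0// bc ltr_pdivrMr// mul1r -[ltRHS]cE.
  exact: beta_lt.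
apply: (mulIf (lt0r_neq0 beta_gt0)); rewrite divfK ?gt_eqF//.
case: (ltgtP c (t * beta)) => // ct.
  by have := stationary_lt hp0 hp1 hmu bc ct; rewrite cE tE ltxx.
by have := stationary_lt hp0 hp1 hmu bt ct; rewrite cE tE ltxx.
Qed.

Lemma Gamma_ge0 {R : realType} (p mu beta : R) :
  0 < p -> p < 1 -> 0 < mu -> 0 <= Gamma p mu beta.
Proof.
move=> hp0 hp1 hmu; rewrite /Gamma; case: ifPn => //; rewrite -ltNge => hb.
have [t [/andP[bt _] [rt tu]]] := shrink_root_unique hp0 hp1 hmu hb.
(* The root set is a singleton, so [xget] returns its root and not the default [0]. *)
rewrite (xget_unique _ rt) => [|u /tu->//].
apply: le_trans bt; rewrite divr_ge0 ?ltW ?beta0_gt0//.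
apply: le_lt_trans hb; apply: le_trans (beta0_le_threshold hp0 hp1 hmu).
by rewrite ltW ?beta0_gt0.
Qed.

Lemma Gamma_objective {R : realType} {p mu beta r : R}
    (hp0 : 0 < p) (hp1 : p < 1) (hmu : 0 < mu) : 0 <= r ->
  objective p mu beta (Gamma p mu beta * beta) <= objective p mu beta r.
Proof.
move=> r0; rewrite /Gamma; case: ifPn => [hb|].
  by rewrite mul0r; exact: objective_below_threshold.
rewrite -ltNge => hb.
have beta_gt0 : 0 < beta.
  apply: le_lt_trans hb; apply: le_trans (beta0_le_threshold hp0 hp1 hmu).
  by rewrite ltW ?beta0_gt0.
have [t [_ [rt tu]]] := shrink_root_unique hp0 hp1 hmu hb.
rewrite (xget_unique _ rt) => [|u /tu->//].
have /shrink_rootE-/(_ hp1 hmu beta_gt0)[bt tE] := rt.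
by rewrite -[X in - X]tE; exact: objective_stationary.
Qed.

(** * The Euclidean norm and the problem for one vector *)

Lemma norm2_ge0 {R : realType} {n : nat} (v : 'cV[R]_n) : 0 <= norm2 v.
Proof. exact: sqrtr_ge0. Qed.

Lemma sqr_norm2 {R : realType} {n : nat} (v : 'cV[R]_n) :
  norm2 v ^+ 2 = \sum_i v i ord0 ^+ 2.
Proof. by rewrite sqr_sqrtr// sumr_ge0// => i _; exact: sqr_ge0. Qed.

Lemma sqr_norm2Z {R : realType} {n : nat} (c : R) (v : 'cV[R]_n) :
  norm2 (c *: v) ^+ 2 = (c * norm2 v) ^+ 2.
Proof.
rewrite exprMn !sqr_norm2 mulr_sumr; apply: eq_bigr => i _.
by rewrite mxE exprMn.
Qed.

Lemma norm2Z {R : realType} {n : nat} (c : R) (v : 'cV[R]_n) : 0 <= c ->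
  norm2 (c *: v) = c * norm2 v.
Proof.
move=> c0; rewrite -[LHS]ger0_norm ?norm2_ge0// -sqrtr_sqr sqr_norm2Z.
by rewrite sqrtr_sqr ger0_norm// mulr_ge0 ?norm2_ge0.
Qed.

Lemma sqr_norm2B {R : realType} {n : nat} (u v : 'cV[R]_n) :
  norm2 (u - v) ^+ 2 =
  norm2 u ^+ 2 + norm2 v ^+ 2 - 2 * \sum_i u i ord0 * v i ord0.
Proof.
rewrite !sqr_norm2 mulr_sumr -big_split/= -sumrB; apply: eq_bigr => i _.
by rewrite !mxE; ring.
Qed.

Lemma norm2_eq0 {R : realType} {n : nat} {v : 'cV[R]_n} : norm2 v = 0 -> v = 0.
Proof.
move=> v0; have := sqr_norm2 v; rewrite v0 expr0n/= => /esym/eqP.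
rewrite psumr_eq0 => [/allP h|i _]; last exact: sqr_ge0.
apply/matrixP => i j; rewrite (ord1 j) mxE.
by have := h i (mem_index_enum i); rewrite /= sqrf_eq0 => /eqP.
Qed.

(** Expand the squared norm of [norm2 v *: u - norm2 u *: v] and cancel [norm2 v * norm2 u]; vectors
    of norm zero are treated first. *)
Lemma Cauchy_Schwarz_cV {R : realType} {n : nat} (u v : 'cV[R]_n) :
  \sum_i u i ord0 * v i ord0 <= norm2 u * norm2 v.
Proof.
have := norm2_ge0 u; rewrite le_eqVlt => /predU1P[/esym u0|u0].
  by rewrite u0 mul0r (norm2_eq0 u0) big1// => i _; rewrite mxE mul0r.
have := norm2_ge0 v; rewrite le_eqVlt => /predU1P[/esym v0|v0].
  by rewrite v0 mulr0 (norm2_eq0 v0) big1// => i _; rewrite mxE mulr0.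
have := sqr_ge0 (norm2 (norm2 v *: u - norm2 u *: v)).
rewrite sqr_norm2B !sqr_norm2Z.
under eq_bigr do rewrite !mxE mulrACA.
rewrite -mulr_sumr => h.
have uv0 : 0 < norm2 v * norm2 u by rewrite mulr_gt0.
rewrite -(ler_pM2l uv0); nra.
Qed.

Lemma sqr_norm2B_ge {R : realType} {n : nat} (u v : 'cV[R]_n) :
  (norm2 u - norm2 v) ^+ 2 <= norm2 (u - v) ^+ 2.
Proof. by rewrite sqr_norm2B; have := Cauchy_Schwarz_cV u v; nra. Qed.

Lemma prox_vec_Gamma {R : realType} {p mu : R} {n : nat} (v : 'cV[R]_n) :
  0 < p -> p < 1 -> 0 < mu ->
  prox_vec p mu v (Gamma p mu (norm2 v) *: v).
Proof.
move=> hp0 hp1 hmu s.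
have -> : norm2 (Gamma p mu (norm2 v) *: v - v) ^+ 2 =
          (Gamma p mu (norm2 v) * norm2 v - norm2 v) ^+ 2.
  by rewrite -[X in _ - X]scale1r -scalerBl sqr_norm2Z mulrBl mul1r.
rewrite norm2Z ?Gamma_ge0//.
apply: le_trans (Gamma_objective hp0 hp1 hmu (norm2_ge0 s)) _.
by rewrite lerD2l ler_pM2l ?sqr_norm2B_ge.
Qed.

(** * Separation of the tensor problem into fibers *)

Local Notation prox_objective p mu v s :=
  (mu * norm2 s `^ p + 1 / 2 * norm2 (s - v) ^+ 2).

Lemma tensor_objectiveE {R : realType} {p : R} (mu : R) {I1 I2 I3 : nat}
    (V S : {ffun 'I_I1 * 'I_I2 * 'I_I3 -> R}) : p != 0 ->
  mu * norm2p p S `^ p + 1 / 2 * normF (S - V) ^+ 2 =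
  \sum_j prox_objective p mu (fiber1 V j.2 j.1) (fiber1 S j.2 j.1).
Proof.
move=> p0; rewrite big_split/= -!mulr_sumr; congr (_ * _ + _ * _).
  rewrite /norm2p -powRrM mul1r mulVf// powRr1.
    by rewrite pair_bigA.
  by do 2 (apply: sumr_ge0 => ? _); exact: powR_ge0.
rewrite sqr_sqrtr; last by apply: sumr_ge0 => i _; exact: sqr_ge0.
under [RHS]eq_bigr do rewrite sqr_norm2.
rewrite pair_bigA/=.
(* The pairs [j] list [i3] before [i2], following the sums in [norm2p], so the triples have to be
   reversed. *)
rewrite (reindex (fun j : 'I_I3 * 'I_I2 * 'I_I1 => (j.2, j.1.2, j.1.1)))/=.
  by apply: eq_bigr => j _; rewrite !mxE !ffunE.
by exists (fun i => (i.2, i.1.2, i.1.1)) => [[[? ?] ?]|[[? ?] ?]].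
Qed.

Definition set_fiber1 {R : realType} {I1 I2 I3 : nat}
    (S : {ffun 'I_I1 * 'I_I2 * 'I_I3 -> R}) (i2 : 'I_I2) (i3 : 'I_I3)
    (s : 'cV[R]_I1) : {ffun 'I_I1 * 'I_I2 * 'I_I3 -> R} :=
  [ffun i => if (i.1.2 == i2) && (i.2 == i3) then s i.1.1 ord0 else S i].

Lemma fiber1_set {R : realType} {I1 I2 I3 : nat}
    (S : {ffun 'I_I1 * 'I_I2 * 'I_I3 -> R}) (i2 j2 : 'I_I2) (i3 j3 : 'I_I3)
    (s : 'cV[R]_I1) :
  fiber1 (set_fiber1 S i2 i3 s) j2 j3 =
  if (j2 == i2) && (j3 == i3) then s else fiber1 S j2 j3.
Proof.
by apply/matrixP => i k; rewrite mxE ffunE/=; case: ifP => _; rewrite ?mxE ?(ord1 k).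
Qed.

Lemma prox_tensorP {R : realType} {p mu : R} {I1 I2 I3 : nat}
    (V S : {ffun 'I_I1 * 'I_I2 * 'I_I3 -> R}) : p != 0 ->
  prox_tensor p mu V S <->
  forall i2 i3, prox_vec p mu (fiber1 V i2 i3) (fiber1 S i2 i3).
Proof.
move=> p0; split=> [minS i2 i3 s|minS T]; last first.
  rewrite [leLHS](tensor_objectiveE mu V S p0).
  by rewrite [leRHS](tensor_objectiveE mu V T p0); apply: ler_sum => j _; exact: minS.
(* Compare with a tensor that differs from [S] in one fiber only: all other summands cancel. *)
have := minS (set_fiber1 S i2 i3 s).
rewrite [leLHS](tensor_objectiveE mu V S p0).
rewrite [leRHS](tensor_objectiveE mu V (set_fiber1 S i2 i3 s) p0).
rewrite [leLHS](bigD1 (i3, i2))//= [leRHS](bigD1 (i3, i2))//=.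
rewrite fiber1_set !eqxx/= [X in _ <= _ + X -> _](eq_bigr (fun j =>
  prox_objective p mu (fiber1 V j.2 j.1) (fiber1 S j.2 j.1))).
  by rewrite lerD2r.
by move=> [j3 j2] ji; rewrite fiber1_set/= andbC -xpair_eqE (negbTE ji).
Qed.

Lemma prox_tensor_Gamma {R : realType} {p mu : R} {I1 I2 I3 : nat}
    (V : {ffun 'I_I1 * 'I_I2 * 'I_I3 -> R}) : 0 < p -> p < 1 -> 0 < mu ->
  prox_tensor p mu V
    [ffun i => Gamma p mu (norm2 (fiber1 V i.1.2 i.2)) * V i].
Proof.
move=> hp0 hp1 hmu; apply/prox_tensorP => [|i2 i3]; first by rewrite gt_eqF.
rewrite [X in prox_vec _ _ _ X](_ : _ =
  Gamma p mu (norm2 (fiber1 V i2 i3)) *: fiber1 V i2 i3).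
  exact: prox_vec_Gamma.
by apply/matrixP => i j; rewrite !mxE ffunE.
Qed.

Lemma prox_vec_fiber1 {R : realType} {p mu : R} {I1 I2 I3 : nat}
    (V : {ffun 'I_I1 * 'I_I2 * 'I_I3 -> R}) (i2 : 'I_I2) (i3 : 'I_I3) :
  0 < p -> p < 1 -> 0 < mu ->
  prox_vec p mu (fiber1 V i2 i3) =
  [set fiber1 S i2 i3 | S in prox_tensor p mu V].
Proof.
move=> hp0 hp1 hmu; have p0 : p != 0 by rewrite gt_eqF.
apply/seteqP; split => [s min_s|_ [S /(prox_tensorP _ _ p0) minS <-]//].
have /(prox_tensorP _ _ p0) minG := prox_tensor_Gamma V hp0 hp1 hmu.
(* A minimizer of one fiber extends to the whole tensor by taking the [Gamma] solution on the other
   fibers. *)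
exists (set_fiber1 [ffun i => Gamma p mu (norm2 (fiber1 V i.1.2 i.2)) * V i]
  i2 i3 s); last by rewrite fiber1_set !eqxx.
apply/(prox_tensorP _ _ p0) => j2 j3; rewrite fiber1_set.
by case: ifPn => [/andP[/eqP-> /eqP->]//|_]; exact: minG.
Qed.

Theorem theorem5p2 (R : realType) (p mu : R)
    (hp0 : 0 < p) (hp1 : p < 1) (hmu : 0 < mu) :
  (* t^* exists and lies in [beta0 / beta, 1[; it is the unique solution in
     [beta0 / beta, +oo[ *)
  (forall beta : R, threshold p mu < beta ->
     exists t : R, beta0 p mu / beta <= t < 1 /\ unique (shrink_root p mu beta) t) /\
  (forall (I1 I2 I3 : nat) (V : {ffun 'I_I1 * 'I_I2 * 'I_I3 -> R}),
     (* the tensor assembled from the fibers below solves the tensor problem *)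
     prox_tensor p mu V
       [ffun i => Gamma p mu (norm2 (fiber1 V i.1.2 i.2)) * V i] /\
     (forall (i2 : 'I_I2) (i3 : 'I_I3),
        prox_vec p mu (fiber1 V i2 i3)
          (Gamma p mu (norm2 (fiber1 V i2 i3)) *: fiber1 V i2 i3) /\
        prox_vec p mu (fiber1 V i2 i3) =
          [set fiber1 S i2 i3 | S in prox_tensor p mu V])).
Proof.
split=> [beta|I1 I2 I3 V]; first exact: shrink_root_unique.
split=> [|i2 i3]; first exact: prox_tensor_Gamma.
by split; [exact: prox_vec_Gamma|exact: prox_vec_fiber1].
Qed.
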